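(* Let $G$ be a connected Lie group with Lie algebra $\mathfrak g$ and let $h\in\mathfrak g$ be an Euler element such that $\tau_h^{\mathfrak g}=e^{\pi i\operatorname{ad}h}$ integrates to an involutive automorphism $\tau_h$ of $G$. Let $M=G/H$ be a homogeneous space and $W\subseteq M$ a non-empty open subset invariant under $\exp(\mathbb R h)$. Let $(U,\mathcal H)$ be an antiunitary representation of $G_{\tau_h}=G\rtimes\{\mathrm{id}_G,\tau_h\}$ and let $\mathsf H$ be a net of closed real subspaces of $\mathcal H$ on open subsets of $M$ satisfying (Iso), (Cov), and the Bisognano--Wichmann property in the sense that $\mathsf H(W)=\mathsf V:=\mathsf V(h,U)$. Then $$\mathsf H_M^{\min}(\mathcal O)\subseteq\mathsf H(\mathcal O)\subseteq\mathsf H_M^{\max}(\mathcal O)\qquad\text{for all open }\mathcal O\subseteq M,$$ and equality holds (in both inclusions) for all domains of the form $\mathcal O=g.W$, $g\in G$.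
   Context: An Euler element is $h\in\mathfrak g$ with $\operatorname{ad}h$ non-zero, diagonalizable, and $\operatorname{Spec}(\operatorname{ad}h)\subseteq\{-1,0,1\}$. An antiunitary representation of $G_{\tau_h}$ is a strongly continuous homomorphism $U$ into the group of unitary or antiunitary operators on a complex Hilbert space $\mathcal H$ with $U(G)$ unitary and $J:=U(\tau_h)$ antiunitary. For $x\in\mathfrak g$, $\partial U(x)$ denotes the infinitesimal generator, $U(\exp tx)=e^{t\,\partial U(x)}$. The standard subspace $\mathsf V(h,U)$ is $\operatorname{Fix}(J\Delta^{1/2})=\{\xi\in\mathcal D(\Delta^{1/2}):J\Delta^{1/2}\xi=\xi\}$ with $\Delta=e^{2\pi i\,\partial U(h)}$. For open $\mathcal O\subseteq M$: $$\mathsf H_M^{\max}(\mathcal O):=\bigcap_{g\in G,\ \mathcal O\subseteq gW}U(g)\mathsf V,\qquad \mathsf H_M^{\min}(\mathcal O):=\overline{\sum_{g\in G,\ gW\subseteq\mathcal O}U(g)\mathsf V},$$ where the empty intersection is $\mathcal H$ and the empty sum is $\{0\}$. (Iso): $\mathcal O_1\subseteq\mathcal O_2$ implies $\mathsf H(\mathcal O_1)\subseteq\mathsf H(\mathcal O_2)$. (Cov): $U(g)\mathsf H(\mathcal O)=\mathsf H(g\mathcal O)$ for $g\in G$. *)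

(* Defs.v *)
From HB Require Import structures.
From mathcomp Require Import all_boot all_order all_algebra.
From mathcomp Require Import complex.
From mathcomp Require Import all_classical all_reals all_analysis.

Set Implicit Arguments.
Unset Strict Implicit.
Unset Printing Implicit Defensive.

Import Order.TTheory GRing.Theory Num.Theory.
Import numFieldNormedType.Exports.

Local Open Scope classical_set_scope.
Local Open Scope quotient_scope.
Local Open Scope complex_scope.
Local Open Scope ring_scope.

(* [A] is meant to be open.  Asking for the iterated derivatives in every
   direction, not only along a basis, is the same as asking for continuous
   partial derivatives up to order [k], as [V] is finite-dimensional below. *)
Fixpoint Ck_on (R : realType) (V W : normedModType R) (k : nat)
    (A : set V) (f : V -> W) : Prop :=
  (forall x, A x -> {for x, continuous f}) /\
  if k is k'.+1 then
    forall v, (forall x, A x -> derivable f x v) /\ Ck_on k' A ('D_v f)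
  else True.

Definition smooth_on (R : realType) (V W : normedModType R)
    (A : set V) (f : V -> W) : Prop :=
  forall k, Ck_on k A f.

Record chart (R : realType) (T : topologicalType) (n : nat) := Chart {
  chart_dom : set T;
  chart_img : set 'rV[R]_n;
  chart_fun : T -> 'rV[R]_n;
  chart_inv : 'rV[R]_n -> T;
  chart_dom_open : open chart_dom;
  chart_img_open : open chart_img;
  chart_funP : forall x, chart_dom x -> chart_img (chart_fun x);
  chart_invP : forall u, chart_img u -> chart_dom (chart_inv u);
  chart_funK : forall x, chart_dom x -> chart_inv (chart_fun x) = x;
  chart_invK : forall u, chart_img u -> chart_fun (chart_inv u) = u;
  chart_fun_cts : forall x, chart_dom x -> {for x, continuous chart_fun};
  chart_inv_cts : forall u, chart_img u -> {for u, continuous chart_inv} }.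

HB.mixin Record isLieGroup (R : realType) G of Group G & Topological G := {
  lie_dim : nat;
  lie_atlas : set (chart R G lie_dim);
  lie_hausdorff : hausdorff_space G;
  lie_second_countable : @second_countable G;
  lie_atlas_cover : forall x : G, exists2 c, lie_atlas c & chart_dom c x;
  lie_atlas_compatible : forall c d, lie_atlas c -> lie_atlas d ->
    smooth_on [set u | chart_img c u /\ chart_dom d (chart_inv c u)]
      (fun u => chart_fun d (chart_inv c u));
  lie_mul_continuous : continuous (fun p : G * G => (p.1 * p.2)%g);
  lie_mul_smooth : forall b c d, lie_atlas b -> lie_atlas c -> lie_atlas d ->
    smooth_on
      [set p : 'rV[R]_lie_dim * 'rV[R]_lie_dim |
        [/\ chart_img b p.1, chart_img c p.2 &
            chart_dom d (chart_inv b p.1 * chart_inv c p.2)%g]]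
      (fun p => chart_fun d (chart_inv b p.1 * chart_inv c p.2)%g);
  lie_inv_continuous : continuous (fun x : G => (x^-1)%g);
  lie_inv_smooth : forall c d, lie_atlas c -> lie_atlas d ->
    smooth_on [set u | chart_img c u /\ chart_dom d ((chart_inv c u)^-1)%g]
      (fun u => chart_fun d ((chart_inv c u)^-1)%g) }.

#[short(type="lieGroupType")]
HB.structure Definition LieGroup (R : realType) :=
  {G of isLieGroup R G & Group G & Topological G}.

Section LieAlgebra.
Variables (R : realType) (G : lieGroupType R).

Definition smooth_fun (f : G -> R) : Prop :=
  forall c, @lie_atlas R G c ->
    smooth_on (chart_img c) (fun u => f (chart_inv c u) : R).

Definition smooth_map (phi : G -> G) : Prop :=
  continuous phi /\
  forall c d, @lie_atlas R G c -> @lie_atlas R G d ->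
    smooth_on [set u | chart_img c u /\ chart_dom d (phi (chart_inv c u))]
      (fun u => chart_fun d (phi (chart_inv c u))).

(* Vector fields, seen as derivations of the algebra of smooth functions. *)
Definition vfield := (G -> R) -> (G -> R).

(* The Lie algebra: left invariant derivations.  The last clause fixes the
   irrelevant values on non-smooth functions, so that equality of operators is
   equality of derivations. *)
Definition lie_algebra : set vfield := [set X |
  [/\ forall f, smooth_fun f -> smooth_fun (X f),
      forall (a : R) f g, smooth_fun f -> smooth_fun g ->
        X (fun x => a * f x + g x) = (fun x => a * X f x + X g x),
      forall f g, smooth_fun f -> smooth_fun g ->
        X (fun x => f x * g x) = (fun x => X f x * g x + f x * X g x),
      forall (a : G) f, smooth_fun f ->
        X (fun x => f (a * x)%g) = (fun x => X f (a * x)%g) &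
      forall f, ~ smooth_fun f -> X f = (fun=> 0)]].

Definition vscale (a : R) (X : vfield) : vfield := fun f x => a * X f x.

Definition lie_ad (X Y : vfield) : vfield :=
  fun f x => X (Y f) x - Y (X f) x.

Definition one_parameter (X : vfield) (gamma : R -> G) : Prop :=
  (forall s t, gamma (s + t) = (gamma s * gamma t)%g) /\
  (forall f, smooth_fun f -> forall t : R,
     is_derive t 1 (fun s => f (gamma s) : R) (X f (gamma t))).

Definition lie_exp (X : vfield) : G :=
  xget 1%g [set x | exists2 gamma, one_parameter X gamma & gamma 1 = x].

Definition lie_diagonalizable (A : vfield -> vfield) : Prop :=
  exists n, exists b : 'I_n -> vfield,
    (forall i, lie_algebra (b i) /\ exists l : R, A (b i) = vscale l (b i)) /\
    (forall X, lie_algebra X -> exists! c : 'rV[R]_n,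
       X = fun f x => \sum_(i < n) c 0 i * b i f x).

(* Real spectral values; a diagonalizable endomorphism of the real Lie algebra
   has no others. *)
Definition lie_spectrum (A : vfield -> vfield) : set R := [set l |
  ~ set_bij lie_algebra lie_algebra
      (fun X f x => A X f x - l * X f x)].

Definition euler_element (h : vfield) : Prop :=
  [/\ lie_algebra h,
      exists2 X, lie_algebra X & lie_ad h X <> (fun _ _ => 0),
      lie_diagonalizable (lie_ad h) &
      lie_spectrum (lie_ad h) `<=` [set -1; 0; 1]].

(* [Y] is [e^(pi i ad h) X], the exponential series being taken in the
   complexified Lie algebra.  Its topology as a finite-dimensional space is that
   of pointwise convergence, because evaluations separate derivations. *)
Definition exp_pi_i_ad (h X Y : vfield) : Prop :=
  forall (f : G -> R) (x : G),
    series (fun n => (pi%:C * 'i) ^+ n / n`!%:R *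
                     (iter n (lie_ad h) X f x)%:C : (R[i] : numFieldType)) @ \oo
      --> ((Y f x)%:C : (R[i] : numFieldType)).

(* [Y] is the image of [X] under the differential of the automorphism [tau],
   i.e. the two fields are [tau]-related. *)
Definition lie_diff (tau : G -> G) (X Y : vfield) : Prop :=
  forall f, smooth_fun f ->
    X (fun x => f (tau x)) = (fun x => Y f (tau x)).

Definition integrates_tau (h : vfield) (tau : G -> G) : Prop :=
  [/\ forall x y, tau (x * y)%g = (tau x * tau y)%g,
      forall x, tau (tau x) = x,
      smooth_map tau &
      forall X, lie_algebra X -> exists Y,
        [/\ lie_algebra Y, exp_pi_i_ad h X Y & lie_diff tau X Y]].

End LieAlgebra.

Record closedSubgroup (R : realType) (G : lieGroupType R) := ClosedSubgroup {
  subgroup_set : set G;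
  subgroup_closed : closed subgroup_set;
  subgroup1 : subgroup_set 1%g;
  subgroupM : forall x y,
    subgroup_set x -> subgroup_set y -> subgroup_set (x * y)%g;
  subgroupV : forall x, subgroup_set x -> subgroup_set (x^-1)%g }.

Section Homogeneous.
Variables (R : realType) (G : lieGroupType R) (K : closedSubgroup G).

Definition same_coset (x y : G) : bool := `[< subgroup_set K (x^-1 * y)%g >].

Lemma same_coset_refl : reflexive same_coset.
Proof. by move=> x; apply/asboolP; rewrite mulVg; exact: subgroup1. Qed.

Lemma same_coset_sym : symmetric same_coset.
Proof.
move=> x y; apply/asboolP/asboolP => /subgroupV;
  by rewrite invgM invgK.
Qed.

Lemma same_coset_trans : transitive same_coset.
Proof.
move=> y x z /asboolP xy /asboolP yz; apply/asboolP.
by move: (subgroupM xy yz); rewrite -!mulgA mulVKg.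
Qed.

Canonical same_coset_equiv :=
  EquivRel same_coset same_coset_refl same_coset_sym same_coset_trans.

Definition homog := quotient_topology {eq_quot same_coset_equiv}.

Definition homog_act (g : G) (m : homog) : homog := \pi_homog (g * repr m)%g.

End Homogeneous.

(* Inner products are linear in the second argument. *)
HB.mixin Record isHilbert (R : realType) H of CompleteNormedModule R[i] H := {
  inner : H -> H -> R[i];
  innerDr : forall x y z, inner x (y + z) = inner x y + inner x z;
  innerZr : forall (a : R[i]) x y, inner x (a *: y) = a * inner x y;
  innerC : forall x y, inner y x = (inner x y)^*;
  inner_norm : forall x, inner x x = `|x| ^+ 2 }.

#[short(type="hilbertType")]
HB.structure Definition Hilbert (R : realType) :=
  {H of isHilbert R H & CompleteNormedModule R[i] H}.

Section SpectralCalculus.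
Variables (R : realType) (H : hilbertType R).

Definition unitary (u : H -> H) : Prop :=
  [/\ forall (a : R[i]) x y, u (a *: x + y) = a *: u x + u y,
      forall y, exists x, u x = y &
      forall x y, inner (u x) (u y) = inner x y].

Definition antiunitary (u : H -> H) : Prop :=
  [/\ forall (a : R[i]) x y, u (a *: x + y) = a^* *: u x + u y,
      forall y, exists x, u x = y &
      forall x y, inner (u x) (u y) = (inner x y)^*].

(* Possibly unbounded operators, given by their graphs. *)
Definition operator := set (H * H).

Definition linear_operator (T : operator) : Prop :=
  [/\ T (0, 0),
      forall (a : R[i]) p q, T p -> T q -> T (a *: p.1 + q.1, a *: p.2 + q.2) &
      forall x y z, T (x, y) -> T (x, z) -> y = z].

Definition op_scale (a : R[i]) (T : operator) : operator :=
  [set p | exists2 y, T (p.1, y) & p.2 = a *: y].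

Definition orthogonal_projection (P : H -> H) : Prop :=
  [/\ forall (a : R[i]) x y, P (a *: x + y) = a *: P x + P y,
      forall x, P (P x) = P x &
      forall x y, inner (P x) y = inner x (P y)].

Definition spectral_measure (E : set (measurableTypeR R) -> H -> H) : Prop :=
  [/\ forall B, measurable B -> orthogonal_projection (E B),
      forall x, E setT x = x &
      forall F : (set (measurableTypeR R))^nat,
        (forall n, measurable (F n)) -> trivIset setT F ->
        forall x, series (fun n => E (F n) x) @ \oo --> E (\bigcup_n F n) x].

(* The finite Borel measure [B |-> <x, E(B) x>]. *)
Definition spectral_mass (E : set (measurableTypeR R) -> H -> H) (x : H)
    (B : set (measurableTypeR R)) : \bar R :=
  (complex.Re (inner x (E B x)))%:E.

(* [T] is the spectral integral of [f]: the operator whose domain is the set of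
   [x] with [f] square integrable for [<x, E x>] and which satisfies
   [<x, T x> = \int f d<x, E x>] there; polarization makes it unique. *)
Definition spectral_integral (E : set (measurableTypeR R) -> H -> H)
    (f : R -> R) (T : operator) : Prop :=
  [/\ linear_operator T,
      forall x, (exists y, T (x, y)) <->
        (\int[spectral_mass E x]_l ((f l) ^+ 2)%:E < +oo)%E &
      forall x y, T (x, y) ->
        inner x y = (fine (\int[spectral_mass E x]_l (f l)%:E)%E)%:C].

(* [f(A)] for a self-adjoint operator [A] and a Borel function [f]; the
   spectral measure [E] of [A] is unique (on Borel sets) by the spectral
   theorem. *)
Definition fun_calculus (f : R -> R) (A : operator) : operator :=
  [set p | exists E T, [/\ spectral_measure E, spectral_integral E idfun A,
                           spectral_integral E f T & T p]].

Definition closed_real_subspace (S : set H) : Prop :=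
  [/\ closed S, S 0 &
      forall (a : R) x y, S x -> S y -> S (a%:C *: x + y)].

End SpectralCalculus.

Section Representation.
Variables (R : realType) (G : lieGroupType R) (H : hilbertType R).

(* The group [G_tau], carried by [G * bool] with the product topology:
   [(g, b)] stands for [g tau^b]. *)
Definition sd_mul (tau : G -> G) (p q : G * bool) : G * bool :=
  ((p.1 * (if p.2 then tau q.1 else q.1))%g, p.2 (+) q.2).

Variable U : G * bool -> H -> H.

Definition antiunitary_rep (tau : G -> G) : Prop :=
  [/\ forall p, unitary (U p) \/ antiunitary (U p),
      forall p q x, U (sd_mul tau p q) x = U p (U q x),
      forall x, continuous (fun p => U p x),
      forall g, unitary (U (g, false)) &
      antiunitary (U (1%g, true))].

Definition generator (X : vfield G) : operator H :=
  [set p | (fun t : R =>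
      (t^-1)%:C *: (U (lie_exp (vscale t X), false) p.1 - p.1)) @ 0^' --> p.2].

Definition modular_operator (h : vfield G) : operator H :=
  fun_calculus (fun l => expR (2 * pi * l)) (op_scale 'i (generator h)).

Definition standard_subspace (h : vfield G) : set H :=
  [set x | exists2 y,
    fun_calculus Num.sqrt (modular_operator h) (x, y) & U (1%g, true) y = x].

End Representation.

Section Nets.
Variables (R : realType) (G : lieGroupType R) (K : closedSubgroup G).
Variables (H : hilbertType R) (U : G * bool -> H -> H) (V : set H).
Variable W : set (homog K).

Definition net_max (O : set (homog K)) : set H :=
  \bigcap_(g in [set g | O `<=` homog_act g @` W]) (U (g, false) @` V).

Definition net_min (O : set (homog K)) : set H :=
  closure [set x | exists n (g : 'I_n -> G) (v : 'I_n -> H),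
    (forall i, homog_act (g i) @` W `<=` O /\ (U (g i, false) @` V) (v i)) /\
    x = \sum_(i < n) v i].

End Nets.

(* Main.v *)
(* For the wedge translate [gW] the element [g] itself occurs as an index both in
   the sum defining the minimal net and in the intersection defining the maximal
   one, so both nets are pinned to [U(g)V = H(gW)] there. *)
Require Import Defs.
From mathcomp Require Import all_boot all_order all_algebra.
From mathcomp Require Import all_classical all_reals all_analysis.
Local Open Scope classical_set_scope.

Import GRing.Theory.

Section HomogAct.
Local Open Scope quotient_scope.
Variables (R : realType) (G : lieGroupType R) (K : closedSubgroup G).

(** The action is defined through the chosen representative [repr]; the choice does not matter,
    because [g] cancels in [(g * x)^-1 * (g * y)], so left translation respects cosets. *)
Lemma homog_act_pi (g x : G) :
  homog_act g (\pi_(homog K) x) = \pi_(homog K) (g * x)%g.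
Proof.
have /eqmodP/asboolP xK : (\pi_(homog K) x = \pi_(homog K) (repr (\pi_(homog K) x))).
  by rewrite reprK.
apply/esym/eqmodP/asboolP.
by rewrite invgM -mulgA mulKg.
Qed.

Lemma homog_actM (g1 g2 : G) (m : homog K) :
  homog_act g1 (homog_act g2 m) = homog_act (g1 * g2)%g m.
Proof. by rewrite [homog_act g2 m]/homog_act homog_act_pi mulgA. Qed.

Lemma homog_act1 (m : homog K) : homog_act 1%g m = m.
Proof. by rewrite /homog_act mul1g reprK. Qed.

(** Since the inverse element acts as the inverse map, images turn into preimages, the form in which
    continuity yields openness. *)
Lemma homog_act_image (g : G) (A : set (homog K)) :
  homog_act g @` A = homog_act g^-1%g @^-1` A.
Proof.
apply/seteqP; split=> [_ [m Am <-]|m Am] /=.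
  by rewrite homog_actM mulVg homog_act1.
by exists (homog_act g^-1%g m) => //; rewrite homog_actM mulgV homog_act1.
Qed.

(** Isotony is assumed between open sets only, so using it on a translate of [W] requires that
    translate to be open. *)
Lemma homog_act_open (g : G) (A : set (homog K)) :
  open A -> open (homog_act g @` A).
Proof.
move=> oA; rewrite homog_act_image.
(* In the quotient topology this is the definition of [open A]; what remains is continuity of left
   translation by [g^-1] on [G]. *)
have oA' : open (\pi_(homog K) @^-1` A : set G) by [].
have mul_cont : continuous (fun x : G => (g^-1 * x)%g).
  move=> x; apply: (cvg_comp (fun y : G => (g^-1%g, y)) (fun p => (p.1 * p.2)%g)).
    exact: cvg_pair (cvg_cst _) cvg_id.
  exact: (@lie_mul_continuous R G (g^-1%g, x)).
have := open_comp (fun x _ => mul_cont x) oA'.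
congr open; apply/seteqP; split=> x /=; by rewrite homog_act_pi.
Qed.

End HomogAct.

Lemma closed_real_subspace_sum (R : realType) (H : hilbertType R) (S : set H)
    (n : nat) (v : 'I_n -> H) :
  closed_real_subspace S -> (forall i, S (v i)) -> S (\sum_(i < n) v i)%R.
Proof.
move=> [_ S0 Slin] Sv; apply: (big_ind S) => // x y Sx Sy.
(* The scalar [1] in the real-linearity clause gives closure under addition. *)
by rewrite -[x]scale1r; exact: (Slin 1%R).
Qed.

Section NetBounds.
Variables (R : realType) (G : lieGroupType R) (K : closedSubgroup G).
Variables (H : hilbertType R) (U : G * bool -> H -> H) (V : set H).
Variables (W O : set (homog K)).

(** As [S] equals its closure, it is enough to place the finite sums in [S]. *)
Lemma net_min_sub (S : set H) : closed_real_subspace S ->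
  (forall g, homog_act g @` W `<=` O -> U (g, false) @` V `<=` S) ->
  net_min U V W O `<=` S.
Proof.
move=> Ssub VS; have [Scl _ _] := Ssub.
rewrite [X in _ `<=` X](closure_id S).1 //; apply: closureS => _ [n [g [v [gv ->]]]].
apply: closed_real_subspace_sum => // i.
by have [gWO] := gv i; exact: VS.
Qed.

Lemma sub_net_min (g : G) : homog_act g @` W `<=` O ->
  U (g, false) @` V `<=` net_min U V W O.
Proof.
move=> gWO x Vx; apply: subset_closure.
(* A single vector is a sum of length one. *)
by exists 1, (fun=> g), (fun=> x); rewrite big_ord1.
Qed.

End NetBounds.

Theorem lemma5p8 (R : realType) (G : lieGroupType R)
    (G_connected : connected [set: G])
    (h : vfield G) (h_euler : euler_element h)
    (tau : G -> G) (tau_h : integrates_tau h tau)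
    (K : closedSubgroup G)
    (W : set (homog K)) (W_nonempty : W !=set0) (W_open : open W)
    (W_invariant : forall t : R,
       homog_act (lie_exp (vscale t h)) @` W = W)
    (H : hilbertType R) (U : G * bool -> H -> H)
    (U_rep : antiunitary_rep U tau)
    (N : set (homog K) -> set H)
    (N_subspace : forall O : set (homog K), open O -> closed_real_subspace (N O))
    (N_iso : forall O1 O2 : set (homog K), open O1 -> open O2 -> O1 `<=` O2 -> N O1 `<=` N O2)
    (N_cov : forall (g : G) (O : set (homog K)), open O ->
       U (g, false) @` N O = N (homog_act g @` O))
    (N_BW : N W = standard_subspace U h) :
  (forall O : set (homog K), open O ->
     net_min U (standard_subspace U h) W O `<=` N O /\
     N O `<=` net_max U (standard_subspace U h) W O) /\
  (forall g : G,
     net_min U (standard_subspace U h) W (homog_act g @` W) =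
       N (homog_act g @` W) /\
     N (homog_act g @` W) =
       net_max U (standard_subspace U h) W (homog_act g @` W)).
Proof.
have W_act g : open (homog_act g @` W) by exact: homog_act_open.
rewrite -N_BW.
have N_min O : open O -> net_min U (N W) W O `<=` N O.
  move=> oO; apply: net_min_sub (N_subspace O oO) _ => g gWO.
  by rewrite N_cov //; exact: N_iso.
have N_max O : open O -> N O `<=` net_max U (N W) W O.
  by move=> oO x Nx g OgW; rewrite N_cov //; exact: N_iso Nx.
split=> [A oA|g]; first by split; [exact: N_min | exact: N_max].
split; apply/seteqP; split; [exact: N_min | | exact: N_max |].
  by rewrite -N_cov //; exact: sub_net_min.
by move=> x; rewrite -N_cov //; apply.
Qed.
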